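(* Let $\lambda$ be a nonzero real number and let $r\ge 0$ be an integer. For all integers $k\ge 0$ and $n\ge 0$, $$\lambda^{n-k}\frac{1}{k!}\triangle^{k}\Big(\frac{r}{\lambda}\Big)^{n}=\begin{cases}{n+r \brace k+r}_{r,\lambda}, & \text{if } n\ge k,\\ 0, & \text{if } 0\le n<k.\end{cases}$$ Here $\triangle^{k}\big(\frac{r}{\lambda}\big)^{n}$ denotes the value at $x=\frac{r}{\lambda}$ of the $k$-th forward difference of the function $x\mapsto x^{n}$.
   Context: For a nonzero real $\lambda$, the generalized falling factorials are $(x)_{0,\lambda}=1$ and $(x)_{n,\lambda}=x(x-\lambda)\cdots(x-(n-1)\lambda)$ for $n\ge 1$. For an integer $r\ge 0$, the $\lambda$-analogues of $r$-Stirling numbers of the second kind ${n+r \brace k+r}_{r,\lambda}$ ($0\le k\le n$) are the real numbers uniquely determined by the polynomial identities in $x$ $$(x+r)^{n}=\sum_{k=0}^{n}{n+r \brace k+r}_{r,\lambda}(x)_{k,\lambda},\quad n\ge 0.$$ The forward difference operator is $\triangle f(x)=f(x+1)-f(x)$, and $\triangle^k$ is its $k$-fold iterate ($\triangle^0 f=f$). Thus $\triangle^{k}\big(\frac{r}{\lambda}\big)^{n}=\sum_{l=0}^{k}\binom{k}{l}(-1)^{k-l}\big(l+\frac{r}{\lambda}\big)^{n}$, with the convention $0^0=1$. *)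

(* Defs.v *)
From mathcomp Require Import all_boot all_order all_algebra.
From mathcomp Require Import boolp classical_sets reals.

Set Implicit Arguments.
Unset Strict Implicit.
Unset Printing Implicit Defensive.

Import Order.TTheory GRing.Theory Num.Theory.
Local Open Scope ring_scope.

(* The ring [A] is arbitrary so that [x] may be the indeterminate ['X]. *)
Definition gfall (A : pzRingType) (lambda x : A) (n : nat) : A :=
  \prod_(i < n) (x - lambda *+ i).

(* [S n k] stands for {n+r brace k+r}_{r,lambda}: both indices are shifted
   by [r]. Only the values with [k <= n] are constrained. *)
Definition is_lrstirling2 (R : realType) (lambda : R) (r : nat)
    (S : nat -> nat -> R) : Prop :=
  forall n : nat,
    ('X + r%:R) ^+ n = \sum_(k < n.+1) S n k *: gfall lambda%:P 'X k
    :> {poly R}.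

(* The values for [k > n] are junk: the defining identities determine the
   values for [k <= n] only (see [lrstirling2P] and [is_lrstirling2_uniq]). *)
Definition lrstirling2 (R : realType) (lambda : R) (r : nat) :
    nat -> nat -> R :=
  xget (fun _ _ => 0) [set S | is_lrstirling2 lambda r S]%classic.

Definition fdiff (R : realType) (f : R -> R) : R -> R :=
  fun x => f (x + 1) - f x.

Lemma gfall_monic_size (R : realType) (lambda : R) (n : nat) :
  gfall lambda%:P 'X n \is monic /\ size (gfall lambda%:P 'X n) = n.+1.
Proof.
have -> : gfall lambda%:P 'X n = \prod_(i < n) ('X - (lambda *+ i)%:P).
  by apply: eq_bigr => i _; rewrite polyCMn.
split; first exact: monic_prod_XsubC.
by rewrite size_prod_XsubC /index_enum -enumT size_enum_ord.
Qed.

Lemma gfall_span (R : realType) (lambda : R) (n : nat) (p : {poly R}) :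
  (size p <= n)%N ->
  exists c : nat -> R, p = \sum_(k < n) c k *: gfall lambda%:P 'X k.
Proof.
elim: n p => [|n IHn] p sp.
  by exists (fun=> 0); rewrite big_ord0; apply/eqP; rewrite -size_poly_leq0.
have [gm gs] := gfall_monic_size lambda n.
have [|c pc] := IHn (p - p`_n *: gfall lambda%:P 'X n).
  apply/leq_sizeP => j; rewrite leq_eqVlt => /predU1P[<-|nj].
    rewrite coefB coefZ; move/monicP: gm; rewrite lead_coefE gs /= => ->.
    by rewrite mulr1 subrr.
  rewrite coefB coefZ nth_default; last exact: leq_trans nj.
  by rewrite (@nth_default R 0 (gfall lambda%:P 'X n)) ?gs // mulr0 subrr.
exists (fun k => if k == n then p`_n else c k).
rewrite big_ord_recr /= eqxx; apply/eqP; rewrite -subr_eq pc; apply/eqP.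
by apply: eq_bigr => i _; rewrite (ltn_eqF (ltn_ord i)).
Qed.

Lemma gfall_free (R : realType) (lambda : R) (n : nat) (c d : nat -> R) :
  \sum_(k < n) c k *: gfall lambda%:P 'X k =
  \sum_(k < n) d k *: gfall lambda%:P 'X k ->
  forall k, (k < n)%N -> c k = d k.
Proof.
elim: n => [//|n IHn] E.
have lt_coef (e : nat -> R) :
    (\sum_(k < n) e k *: gfall lambda%:P 'X k)`_n = 0.
  rewrite coef_sum big1 // => i _; rewrite coefZ nth_default ?mulr0 //.
  by have [_ ->] := gfall_monic_size lambda i.
have [gm gs] := gfall_monic_size lambda n.
have cdn : c n = d n.
  move: (congr1 (fun p : {poly R} => p`_n) E).
  rewrite /= !big_ord_recr /= !coefD !lt_coef !coefZ !add0r.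
  by move/monicP: gm; rewrite lead_coefE gs /= => ->; rewrite !mulr1.
move: E; rewrite !big_ord_recr /= cdn => /addIr/IHn E k.
by rewrite ltnS leq_eqVlt => /predU1P[->|/E].
Qed.

Lemma lrstirling2P (R : realType) (lambda : R) (r : nat) :
  is_lrstirling2 lambda r (lrstirling2 lambda r).
Proof.
have H n : exists c : nat -> R,
    ('X + r%:R) ^+ n = \sum_(k < n.+1) c k *: gfall lambda%:P 'X k
    :> {poly R}.
  apply: gfall_span; rewrite -polyC_natr -[_%:P]opprK -polyCN.
  by rewrite size_exp_XsubC.
have [S HS] := choice H.
exact: (@xgetPex _ (fun _ _ => 0) [set S | is_lrstirling2 lambda r S]%classic
         (ex_intro _ S HS)).
Qed.

Lemma is_lrstirling2_uniq (R : realType) (lambda : R) (r : nat)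
    (S T : nat -> nat -> R) :
  is_lrstirling2 lambda r S -> is_lrstirling2 lambda r T ->
  forall n k, (k <= n)%N -> S n k = T n k.
Proof.
move=> HS HT n k kn; apply: (@gfall_free _ lambda n.+1) => //.
by rewrite -HS -HT.
Qed.

(* Main.v *)
(* Substituting x = lambda y in the defining identities and dividing by
   lambda^n gives the Newton expansion of (y + r/lambda)^n in the ordinary
   falling factorials (y)_j, with coefficients lambda^(j-n) {n+r brace j+r}.
   Since the k-th difference of (y)_j is j(j-1)...(j-k+1) (y)_(j-k), evaluating
   it at y = 0 isolates k! times the k-th coefficient. *)
Require Import Defs.
From mathcomp Require Import all_boot all_order all_algebra.
From mathcomp Require Import boolp classical_sets reals.
From mathcomp Require Import ring.

Set Implicit Arguments.
Unset Strict Implicit.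
Unset Printing Implicit Defensive.

Import Order.TTheory GRing.Theory Num.Theory.
Local Open Scope ring_scope.

Lemma horner_gfall (R : comNzRingType) (lambda x : R) (n : nat) :
  (gfall lambda%:P 'X n).[x] = gfall lambda x n.
Proof.
rewrite /gfall horner_prod; apply: eq_bigr => i _.
by rewrite hornerD hornerN hornerMn hornerX hornerC.
Qed.

Lemma gfall_scale (R : comPzRingType) (lambda y : R) (n : nat) :
  gfall lambda (lambda * y) n = lambda ^+ n * gfall 1 y n.
Proof.
rewrite -[in lambda ^+ n](card_ord n) -prodrMl; apply: eq_bigr => i _.
by rewrite mulrBr mulrnAr mulr1.
Qed.

(** For [n] positive, $(y+1)_n$ and $(y)_n$ share the factor $(y)_{n-1}$, and their remaining
    factors $y+1$ and $y-n+1$ differ by $n$. For [n] zero, the value at [n.-1] is harmless, being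
    multiplied by 0. *)
Lemma gfall1_diff (R : comPzRingType) (y : R) (n : nat) :
  gfall 1 (y + 1) n - gfall 1 y n = n%:R * gfall 1 y n.-1.
Proof.
case: n => [|n]; first by rewrite /gfall !big_ord0 subrr mul0r.
rewrite {1}/gfall big_ord_recl mulr0n subr0.
under eq_bigr => i _ do rewrite lift0 mulrS opprD addrA addrK.
rewrite [gfall 1 y n.+1]/gfall big_ord_recr /= -/(gfall 1 y n) [gfall 1 y n * _]mulrC -mulrBl.
by rewrite opprB addrA addrAC (addrC y) addrK mulrSr addrC.
Qed.

Lemma gfall_at0 (R : comPzRingType) (lambda : R) (n : nat) :
  gfall lambda 0 n = (n == 0)%:R.
Proof.
case: n => [|n]; first by rewrite /gfall big_ord0.
by rewrite /gfall big_ord_recl mulr0n subrr mul0r.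
Qed.

(** The shift by [a] turns evaluation at [a] into evaluation of a falling factorial at 0. When
    [j < k] the truncated [j - k] does no harm, since [j ^_ k] is then 0. *)
Lemma iter_fdiff_gfall1 (R : realType) (a : R) (j k : nat) :
  iter k (@fdiff R) (fun x => gfall 1 (x - a) j)
  = fun x => (j ^_ k)%:R * gfall 1 (x - a) (j - k).
Proof.
elim: k => [|k IHk]; first by apply/funext => x /=; rewrite mul1r subn0.
apply/funext => x; rewrite iterS IHk /fdiff -mulrBr addrAC gfall1_diff.
by rewrite mulrA -natrM -ffactnSr subnS.
Qed.

Lemma iter_fdiff_sum (R : realType) (m k : nat) (c : nat -> R)
    (f : nat -> R -> R) :
  iter k (@fdiff R) (fun x => \sum_(j < m) c j * f j x)
  = fun x => \sum_(j < m) c j * iter k (@fdiff R) (f j) x.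
Proof.
elim: k => [//|k IHk]; apply/funext => x; rewrite iterS IHk /fdiff -sumrB.
by apply: eq_bigr => j _; rewrite -mulrBr.
Qed.

Lemma exprn_newton (R : realType) (lambda : R) (r n : nat) (x : R) :
  lambda != 0 ->
  x ^+ n = \sum_(j < n.+1) (lambda ^- n * (lrstirling2 lambda r n j * lambda ^+ j))
             * gfall 1 (x - r%:R / lambda) j.
Proof.
move=> l0; have ln0 : lambda ^+ n != 0 by rewrite expf_neq0.
(* Clearing $\lambda^{-n}$ makes the left side $(\lambda x)^n$, which is the defining identity
   evaluated at $\lambda(x-r/\lambda)=\lambda x-r$. *)
apply: (mulfI ln0); rewrite mulr_sumr -exprMn.
have -> : lambda * x = lambda * (x - r%:R / lambda) + r%:R.
  by rewrite mulrBr [lambda * (_ / _)]mulrCA divff // mulr1 subrK.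
have /(congr1 (horner^~ (lambda * (x - r%:R / lambda)))) /= :=
  lrstirling2P lambda r n.
rewrite horner_exp hornerD hornerX -polyC_natr hornerC => ->.
rewrite horner_sum; apply: eq_bigr => j _.
by rewrite hornerZ horner_gfall gfall_scale -!mulrA mulVKf.
Qed.

Theorem theorem2 (R : realType) (lambda : R) (r : nat) (k n : nat) :
  lambda != 0 ->
  lambda ^ (n%:Z - k%:Z) * (1 / k`!%:R)
    * iter k (@fdiff R) (fun x : R => x ^+ n) (r%:R / lambda)
  = if (k <= n)%N then lrstirling2 lambda r n k else 0.
Proof.
move=> l0.
rewrite (funext (fun x => exprn_newton r n x l0)).
rewrite (@iter_fdiff_sum _ _ _
  (fun j => lambda ^- n * (lrstirling2 lambda r n j * lambda ^+ j))
  (fun j x => gfall 1 (x - r%:R / lambda) j)).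
(* Only index [k] survives at $r/\lambda$: below it the coefficient [j ^_ k] vanishes, above it a
   falling factorial of positive length is taken at 0. *)
have term0 (j : nat) : j != k ->
    iter k (@fdiff R) (fun x => gfall 1 (x - r%:R / lambda) j) (r%:R / lambda)
    = 0.
  rewrite iter_fdiff_gfall1 subrr gfall_at0 subn_eq0 neq_ltn.
  case/orP => [jk|kj]; first by rewrite ffact_small // mul0r.
  by rewrite leqNgt kj mulr0.
case: leqP => [kn|nk]; last first.
  (* The expansion stops at index [n], so it never reaches [k]. *)
  rewrite big1 ?mulr0 // => j _; rewrite term0 ?mulr0 //.
  by rewrite ltn_eqF // (leq_trans (ltn_ord j)).
rewrite (bigD1 (Ordinal (kn : (k < n.+1)%N))) //= big1 ?addr0; last first.
  by move=> j jk; rewrite term0 ?mulr0.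
rewrite iter_fdiff_gfall1 subrr gfall_at0 subnn eqxx mulr1 ffactnn.
have f0 : k`!%:R != 0 :> R by rewrite pnatr_eq0 -lt0n fact_gt0.
have ln0 : lambda ^+ n != 0 by rewrite expf_neq0.
have lk0 : lambda ^+ k != 0 by rewrite expf_neq0.
(* The surviving term is $\lambda^{k-n}\,k!$ times the Stirling number, and the prefactor cancels
   it. *)
by rewrite expfzDr // -exprnN -exprnP; field; rewrite ?f0 ?ln0 ?lk0.
Qed.
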